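(* Let $\alpha\in\mathbb{R}$, let $k\ge 1$ be an integer, let $P_1$ be a real polynomial of degree $k+1$, and write $P_2(x)=P_1(x-1)-P_1(x)$ (so that $P_2$ is a polynomial of degree $k$). Assume that $P_2(-n)\neq 0$ for $n\ge 0$, and define $$\gamma_{n+1}=P_2(-n)\ (n\ge 0),\qquad \lambda_n=P_1(-n)\ (n\ge 0),\qquad \beta_n=-\frac{\gamma_{n+1}}{\gamma_n}\ (n\ge 1),$$ and the polynomials $q_0=1$ and $q_n=L_n^\alpha+\beta_nL_{n-1}^\alpha$ for $n\ge 1$, where $L_n^\alpha$ is the $n$-th Laguerre polynomial. Let $$D=P_1(D_\alpha)+\frac{d}{dx}P_2(D_\alpha),$$ where $D_\alpha$ is the second order Laguerre differential operator. Then $D$ is a differential operator of order $2k+2$, and $D(q_n)=\lambda_nq_n$ for all $n\ge 0$.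
   Context: Laguerre polynomials: $L_n^\alpha(x)=\sum_{j=0}^n\frac{(-x)^j}{j!}\binom{n+\alpha}{n-j}$. Laguerre operator: $D_\alpha=x\left(\frac{d}{dx}\right)^2+(\alpha+1-x)\frac{d}{dx}$, which satisfies $D_\alpha(L_n^\alpha)=-nL_n^\alpha$. For a linear operator $T$ and a polynomial $P(x)=\sum_ja_jx^j$, $P(T)=\sum_ja_jT^j$; products of operators are compositions. *)

(* Defs.v *)
From mathcomp Require Import all_boot all_order all_algebra.
From mathcomp Require Import reals.

Set Implicit Arguments.
Unset Strict Implicit.
Unset Printing Implicit Defensive.

Import Order.TTheory GRing.Theory Num.Theory.
Local Open Scope ring_scope.

Section Defs.
Variable R : realType.
Implicit Types (a x : R) (m n : nat) (P p : {poly R}).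

(* Binomial coefficient with real upper argument:
   x (x - 1) ... (x - m + 1) / m! *)
Definition rbinom x m : R := (\prod_(i < m) (x - i%:R)) / m`!%:R.

Definition laguerre a n : {poly R} :=
  \sum_(j < n.+1) (rbinom (n%:R + a) (n - j) / j`!%:R) *: (- 'X) ^+ j.

Definition laguerre_op a : {poly R} -> {poly R} := fun p =>
  'X * p^`(2) + ((a + 1)%:P - 'X) * p^`().

Definition poly_of_op P (T : {poly R} -> {poly R}) : {poly R} -> {poly R} :=
  fun p => \sum_(j < size P) P`_j *: iter j T p.

(* T = f_m (d/dx)^m + ... + f_0 as operators on R[x], with polynomial
   coefficients and f_m <> 0.  Since R has characteristic 0 the f_j are
   determined by T, so T has at most one order in this sense. *)
Definition diff_op_of_order m (T : {poly R} -> {poly R}) : Prop :=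
  exists f : 'I_m.+1 -> {poly R},
    f ord_max != 0 /\ forall p, T p = \sum_(j < m.+1) f j * p^`(j).

End Defs.

(* Main.v *)
Require Import Defs.
From mathcomp Require Import all_boot all_order all_algebra.
From mathcomp Require Import reals ring.

Set Implicit Arguments.
Unset Strict Implicit.
Unset Printing Implicit Defensive.

Import Order.TTheory GRing.Theory Num.Theory.
Local Open Scope ring_scope.

(** Write [L n] for the n-th Laguerre polynomial and [Da] for the Laguerre
operator.  Since [Da (L n) = - n *: L n] ([laguerre_op_eigen]), every
polynomial in [Da] acts on [L n] by a scalar, so that
[D (L n) = P1(-n) L n + P2(-n) (L n)'].  In [D (q n)] the two derivatives then
carry the coefficients [P2(-n)] and [beta n * P2(-(n - 1)) = - P2(-n)]: the
choice of [beta] is exactly what makes them combine into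
[P2(-n) ((L n)' - (L n.-1)')], which is [- P2(-n) (L n.-1)] by
[deriv_laguerre_rec].  No derivative is left, and the coefficient of [L n.-1]
is [beta n * P1(-(n - 1)) - P2(-n)], which equals [beta n * P1(-n)] because
[P2(-(n - 1)) = P1(-n) - P1(-(n - 1))].

For the order, [Da] has leading term ['X (d/dx)^2]; leading terms multiply
under composition, so [P1(Da)] has the single leading term
[lead_coef P1 * 'X^(k+1) (d/dx)^(2k+2)], while the derivative of [P2(Da)]
stops at order [2k+1] ([has_leading_poly_of_laguerre_op],
[has_leading_deriv]).  The degree of [P2] is read off from the fact that
[P1(x - 1) - P1(x)] and [- P1'(x)] differ by a polynomial of degree less than
[k] ([size_backward_difference]). *)

(** * Binomial coefficients with a real upper argument *)

Lemma rbinom0 (R : realType) (x : R) : rbinom x 0 = 1.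
Proof. by rewrite /rbinom big_ord0 fact0 divr1. Qed.

Lemma rbinomS (R : realType) (x : R) m :
  m.+1%:R * rbinom x m.+1 = (x - m%:R) * rbinom x m.
Proof.
rewrite /rbinom big_ord_recr factS natrM /=.
have m1_neq0 : m.+1%:R != 0 :> R by rewrite pnatr_eq0.
have fm_neq0 : m`!%:R != 0 :> R by rewrite pnatr_eq0 -lt0n fact_gt0.
by field; rewrite fm_neq0 addrC natr1 m1_neq0.
Qed.

Lemma rbinomS1 (R : realType) (x : R) m :
  m.+1%:R * rbinom (x + 1) m.+1 = (x + 1) * rbinom x m.
Proof.
rewrite /rbinom big_ord_recl factS natrM subr0.
under eq_bigr => i _.
  have -> : x + 1 - (lift ord0 i)%:R = x - i%:R by rewrite lift0 -natr1; ring.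
  over.
have m1_neq0 : m.+1%:R != 0 :> R by rewrite pnatr_eq0.
have fm_neq0 : m`!%:R != 0 :> R by rewrite pnatr_eq0 -lt0n fact_gt0.
by field; rewrite fm_neq0 addrC natr1 m1_neq0.
Qed.

(** Pascal's rule. Both sides, multiplied by [m.+1], are multiples of
[rbinom x m], with equal factors [x + 1 = (x - m) + m.+1]. *)
Lemma rbinom_pascal (R : realType) (x : R) m :
  rbinom (x + 1) m.+1 = rbinom x m.+1 + rbinom x m.
Proof.
have m1_neq0 : m.+1%:R != 0 :> R by rewrite pnatr_eq0.
apply: (mulfI m1_neq0); rewrite mulrDr rbinomS1 rbinomS -natr1; ring.
Qed.

(** * Laguerre polynomials and the Laguerre operator *)

Lemma coef_laguerre (R : realType) (a : R) n j :
  (laguerre a n)`_j =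
  if (j <= n)%N then (-1) ^+ j * rbinom (n%:R + a) (n - j) / j`!%:R else 0.
Proof.
have -> : laguerre a n =
    \poly_(i < n.+1) ((-1) ^+ i * rbinom (n%:R + a) (n - i) / i`!%:R).
  rewrite poly_def; apply: eq_bigr => i _.
  rewrite -[LHS]mul_polyC -[RHS]mul_polyC (exprNn (R := {poly R}) 'X).
  have -> : (-1) ^+ i = ((-1) ^+ i)%:P :> {poly R} by rewrite rmorphXn rmorphN1.
  by rewrite mulrA -polyCM; congr (_%:P * _); ring.
by rewrite coef_poly ltnS.
Qed.

Lemma laguerre0 (R : realType) (a : R) : laguerre a 0 = 1.
Proof.
by rewrite /laguerre big_ord1 subnn rbinom0 fact0 divr1 expr0 scale1r.
Qed.

(** Comparison of the coefficients of ['X^j] in the differential equation of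
the Laguerre polynomials gives this two-term recurrence, which for [j < n] is
the recurrence [rbinomS] in the lower argument of the binomial. *)
Lemma laguerre_coef_rec (R : realType) (a : R) n j :
  j.+1%:R * (j.+1%:R + a) * (laguerre a n)`_j.+1
    = (j%:R - n%:R) * (laguerre a n)`_j.
Proof.
rewrite !coef_laguerre; case: ltngtP => [jn|jn|->]; last 2 first.
- by rewrite !mulr0.
- by rewrite subrr mul0r mulr0.
(* writing [n = m + j.+1] removes the truncated subtractions *)
have -> : n = (n - j.+1 + j.+1)%N by rewrite subnK.
move: (n - j.+1)%N => m.
rewrite addnK addnS -addSn addnK factS natrM natrD exprS.
have := rbinomS (m.+1%:R + j%:R + a) m; rewrite -!natr1.
set r := rbinom _ m; set r1 := rbinom _ m.+1 => e.
have j1_neq0 : j%:R + 1 != 0 :> R by rewrite natr1 pnatr_eq0.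
have fj_neq0 : j`!%:R != 0 :> R by rewrite pnatr_eq0 -lt0n fact_gt0.
transitivity (- (-1) ^+ j * ((m%:R + 1) * r1) / j`!%:R); last first.
  by field; rewrite fj_neq0.
by rewrite e; field; rewrite fj_neq0.
Qed.

(** The operator only links the coefficients of ['X^j] and ['X^j.+1], and
[laguerre_coef_rec] expresses the latter through the former. *)
Lemma laguerre_op_eigen (R : realType) (a : R) n :
  laguerre_op a (laguerre a n) = - n%:R *: laguerre a n.
Proof.
apply/polyP => j; rewrite /laguerre_op mulrBl coefD coefB coefZ.
rewrite coefCM !coefXM derivnS derivn1 !coef_deriv.
have := laguerre_coef_rec a n j.
case: j => [|j] /= e.
  transitivity ((0%:R - n%:R) * (laguerre a n)`_0); last by ring.
  by rewrite -e; ring.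
transitivity ((j.+1%:R - n%:R) * (laguerre a n)`_j.+1
             - j.+1%:R * (laguerre a n)`_j.+1); last by ring.
by rewrite -e -!natr1; ring.
Qed.

(** Coefficientwise this is [rbinom_pascal]; the coefficient of ['X^n], where
[(laguerre a n)^`()] has none, is the initial value [rbinom0]. It is this
identity that turns the derivatives in [D (q n)] back into a Laguerre
polynomial. *)
Lemma deriv_laguerre_rec (R : realType) (a : R) n :
  (laguerre a n.+1)^`() - (laguerre a n)^`() = - laguerre a n.
Proof.
apply/polyP => j; rewrite coefB coefN !coef_deriv -mulrnBl !coef_laguerre ltnS.
have j1_neq0 : j%:R + 1 != 0 :> R by rewrite natr1 pnatr_eq0.
have fj_neq0 : j`!%:R != 0 :> R by rewrite pnatr_eq0 -lt0n fact_gt0.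
have na : n.+1%:R + a = n%:R + a + 1 by rewrite -natr1; ring.
rewrite subSS na -[LHS]mulr_natr factS natrM exprS -natr1.
case: ltngtP => [jn|jn|->].
- have -> : n = (n - j.+1 + j.+1)%N by rewrite subnK.
  move: (n - j.+1)%N => m.
  rewrite addnK addnS -addSn addnK rbinom_pascal.
  by field; rewrite fj_neq0.
- by rewrite subrr mul0r oppr0.
- rewrite subnn !rbinom0 subr0.
  have n1_neq0 : n%:R + 1 != 0 :> R by rewrite natr1 pnatr_eq0.
  have fn_neq0 : n`!%:R != 0 :> R by rewrite pnatr_eq0 -lt0n fact_gt0.
  by field; rewrite fn_neq0.
Qed.

(** * Polynomials in the Laguerre operator *)

Lemma laguerre_op_lin (R : realType) (a c : R) (u v : {poly R}) :
  laguerre_op a (u + c *: v) = laguerre_op a u + c *: laguerre_op a v.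
Proof.
rewrite /laguerre_op !derivnS !derivn0 !derivD !derivZ -!mul_polyC; ring.
Qed.

Lemma poly_of_laguerre_op_lin (R : realType) (P : {poly R}) (a c : R)
    (u v : {poly R}) :
  poly_of_op P (laguerre_op a) (u + c *: v) =
  poly_of_op P (laguerre_op a) u + c *: poly_of_op P (laguerre_op a) v.
Proof.
have iter_lin j : iter j (laguerre_op a) (u + c *: v)
    = iter j (laguerre_op a) u + c *: iter j (laguerre_op a) v.
  by elim: j => //= j ->; rewrite laguerre_op_lin.
rewrite /poly_of_op scaler_sumr -big_split /=; apply: eq_bigr => j _.
by rewrite iter_lin scalerDr !scalerA mulrC.
Qed.

Lemma poly_of_laguerre_op_eigen (R : realType) (P : {poly R}) (a : R) n :
  poly_of_op P (laguerre_op a) (laguerre a n) = P.[- n%:R] *: laguerre a n.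
Proof.
have iter_eigen j : iter j (laguerre_op a) (laguerre a n)
    = (- n%:R) ^+ j *: laguerre a n.
  elim: j => [|j /= ->]; first by rewrite expr0 scale1r.
  have := laguerre_op_lin a ((- n%:R) ^+ j) 0 (laguerre a n).
  rewrite !add0r => ->; rewrite laguerre_op_eigen scalerA exprSr.
  by rewrite /laguerre_op derivnS derivn1 !deriv0 !mulr0 !add0r.
rewrite /poly_of_op horner_coef scaler_suml; apply: eq_bigr => j _.
by rewrite iter_eigen scalerA.
Qed.

(** * Orders of differential operators *)

(** [c] may be zero, so [m] only bounds the order: this lets operators of
different orders be added after widening the smaller one. The coefficients are
indexed by [nat] rather than by ['I_m.+1] so that [m] can change freely. *)
Definition has_leading (R : realType) (m : nat) (c : {poly R})
    (T : {poly R} -> {poly R}) : Prop :=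
  exists f : nat -> {poly R},
    f m = c /\ forall p, T p = \sum_(j < m.+1) f j * p^`(j).

Section LeadingCoefficient.
Variable R : realType.
Implicit Types (c g : {poly R}) (T S : {poly R} -> {poly R}) (m : nat).

Lemma has_leadingD m c c' T S :
  has_leading m c T -> has_leading m c' S ->
  has_leading m (c + c') (fun p => T p + S p).
Proof.
move=> [f [<- Tf]] [g [<- Sg]]; exists (fun j => f j + g j); split=> // p.
by rewrite Tf Sg -big_split; apply: eq_bigr => j _; rewrite mulrDl.
Qed.

Lemma has_leadingM m g c T :
  has_leading m c T -> has_leading m (g * c) (fun p => g * T p).
Proof.
move=> [f [<- Tf]]; exists (fun j => g * f j); split=> // p.
by rewrite Tf mulr_sumr; apply: eq_bigr => j _; rewrite mulrA.
Qed.

Lemma has_leading_widen m c T : has_leading m c T -> has_leading m.+1 0 T.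
Proof.
move=> [f [_ Tf]]; exists (fun j => if (j <= m)%N then f j else 0).
split=> [|p]; first by rewrite ltnn.
rewrite big_ord_recr /= ltnn mul0r addr0 Tf.
by apply: eq_bigr => j _; rewrite -ltnS ltn_ord.
Qed.

(** By Leibniz's rule [d/dx f_j (d/dx)^j = f_j' (d/dx)^j + f_j (d/dx)^(j+1)]:
the first summands do not raise the order, and the second ones shift the
coefficients by one. *)
Lemma has_leading_deriv m c T :
  has_leading m c T -> has_leading m.+1 c (fun p => (T p)^`()).
Proof.
move=> [f [fm Tf]].
have coef_part : has_leading m (f m)^`()
    (fun p => \sum_(j < m.+1) (f j)^`() * p^`(j)).
  by exists (fun j => (f j)^`()).
have shift_part : has_leading m.+1 c
    (fun p => \sum_(j < m.+1) f j * p^`(j.+1)).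
  exists (fun j => if j is i.+1 then f i else 0); split=> // p.
  by rewrite [RHS]big_ord_recl mul0r add0r.
have [g [gm Tg]] := has_leadingD (has_leading_widen coef_part) shift_part.
exists g; split=> [|p]; first by rewrite gm add0r.
rewrite -Tg Tf raddf_sum -big_split; apply: eq_bigr => j _ /=.
by rewrite derivM.
Qed.

(** Only the part ['X (d/dx)^2] of the operator reaches order [m.+2]. *)
Lemma has_leading_laguerre m (a : R) c T :
  has_leading m c T -> has_leading m.+2 ('X * c) (fun p => laguerre_op a (T p)).
Proof.
move=> Tc; have T'c := has_leading_deriv Tc.
have := has_leadingD (has_leadingM 'X (has_leading_deriv T'c))
  (has_leading_widen (has_leadingM ((a + 1)%:P - 'X) T'c)).
by rewrite addr0.
Qed.

Lemma has_leading_iter_laguerre (a : R) j :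
  has_leading j.*2 'X^j (iter j (laguerre_op a)).
Proof.
elim: j => [|j IHj]; last by rewrite doubleS exprS; apply: has_leading_laguerre.
exists (fun=> 1); split=> [|p]; first by rewrite expr0.
by rewrite big_ord1 mul1r.
Qed.

(** The summand with index [j] has order [2 j], so only the last one
contributes to the leading term. *)
Lemma has_leading_poly_of_laguerre_op (P : {poly R}) (a : R) m :
  size P = m.+1 ->
  has_leading m.*2 (lead_coef P *: 'X^m) (poly_of_op P (laguerre_op a)).
Proof.
move=> szP; rewrite lead_coefE szP /poly_of_op {}szP /=.
have term j : has_leading j.*2 (P`_j *: 'X^j)
    (fun p => P`_j *: iter j (laguerre_op a) p).
  have [f [fj Tf]] := has_leadingM (P`_j)%:P (has_leading_iter_laguerre a j).
  exists f; split=> [|p]; first by rewrite fj mul_polyC.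
  by rewrite -Tf mul_polyC.
elim: m => [|m IHm].
  have [f [fj Tf]] := term 0%N; exists f; split=> // p.
  by rewrite big_ord1 Tf.
have := has_leadingD (has_leading_widen (has_leading_widen IHm)) (term m.+1).
rewrite add0r => -[f [fj Tf]]; exists f; split=> // p.
by rewrite -Tf [LHS]big_ord_recr.
Qed.

End LeadingCoefficient.

(** * The backward difference of a polynomial *)

(** The first two terms of the expansion of [('X - 1)^(i+1)] are
['X^(i+1) - (i+1) 'X^i]. In the induction, the remainder for the next exponent
is [('X - 1)] times the present one plus [(i+1) 'X^i]. *)
Lemma size_expXsub1 (R : realType) i :
  (size (('X - 1%:P) ^+ i.+1 - 'X^(i.+1) + (i.+1%:R)%:P * 'X^i : {poly R})%R
     <= i)%N.
Proof.
elim: i => [|i IHi].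
  by rewrite !expr1 expr0 mulr1 addrAC subrK subrr size_poly0.
set e := (X in size X) in IHi.
have -> : ('X - 1%:P) ^+ i.+2 - 'X^(i.+2) + i.+2%:R%:P * 'X^(i.+1)
    = ('X - 1%:P) * e + i.+1%:R%:P * 'X^i :> {poly R}.
  have collect (x y z c : {poly R}) :
      (x - 1) * ((x - 1) * y) - x * (x * z) + (c + 1 + 1) * (x * z)
      = (x - 1) * ((x - 1) * y - x * z + (c + 1) * z) + (c + 1) * z by ring.
  by rewrite /e -!natr1 !exprS !polyCD polyC1; apply: collect.
apply: leq_trans (size_polyD _ _) _; rewrite geq_max; apply/andP; split.
  apply: leq_trans (size_polyMleq _ _) _.
  by rewrite size_XsubC /= ltnS.
by rewrite mul_polyC (leq_trans (size_scale_leq _ _)) // size_polyXn.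
Qed.

(** To leading order the difference is [- P^`()], whose degree is one less than
that of [P] in characteristic zero. *)
Lemma size_backward_difference (R : realType) (P : {poly R}) m :
  size P = m.+2 -> size ((P \Po ('X - 1%:P)) - P) = m.+1.
Proof.
move=> szP.
have szP' : size (- P^`()) = m.+1.
  apply/eqP; rewrite size_polyN eqn_leq; apply/andP; split.
    by rewrite -ltnS -szP lt_size_deriv // -size_poly_gt0 szP.
  rewrite ltnNge; apply/negP => /leq_sizeP /(_ _ (leqnn m))/eqP; apply/negP.
  rewrite coef_deriv mulrn_eq0 /= -[m.+1]/(m.+2.-1) -szP.
  by rewrite -lead_coefE lead_coef_eq0 -size_poly_gt0 szP.
have -> : (P \Po ('X - 1%:P)) - P
    = - P^`() + ((P \Po ('X - 1%:P)) - P + P^`()) by rewrite [RHS]addrC addrK.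
rewrite size_polyDl szP' // ltnS.
have -> : (P \Po ('X - 1%:P)) - P + P^`() = \sum_(i < size P)
    P`_i *: (('X - 1%:P) ^+ i - 'X^i + i%:R%:P * 'X^(i.-1)).
  have PE : \sum_(i < size P) P`_i *: 'X^i = P by rewrite -poly_def coefK.
  rewrite comp_polyE -[X in _ - X + _]PE -[X in X^`()]PE -sumrB.
  rewrite raddf_sum -big_split /=.
  apply: eq_bigr => i _; rewrite derivZ derivXn scalerDr scalerBr.
  by rewrite mul_polyC scaler_nat.
apply: leq_trans (size_sum _ _ _) _; apply/bigmax_leqP => -[[|i] /= lti] _.
  by rewrite !expr0 subrr mul0r addr0 scaler0 size_poly0.
apply: leq_trans (size_scale_leq _ _) _; apply: leq_trans (size_expXsub1 _ i) _.
by rewrite szP !ltnS in lti.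
Qed.

(** * The eigenvalue equation and the order *)

Theorem theorem8p2 (R : realType) (a : R) (k : nat) (P1 P2 : {poly R})
    (gamma lambda beta : nat -> R) (q : nat -> {poly R})
    (D : {poly R} -> {poly R})
    (hk : (1 <= k)%N)
    (hP1 : size P1 = k.+2)
    (hP2 : P2 = (P1 \Po ('X - 1%:P)) - P1)
    (hP2n : forall n : nat, P2.[- n%:R] != 0)
    (hgamma : forall n : nat, gamma n.+1 = P2.[- n%:R])
    (hlambda : forall n : nat, lambda n = P1.[- n%:R])
    (hbeta : forall n : nat, (1 <= n)%N -> beta n = - (gamma n.+1 / gamma n))
    (hq0 : q 0%N = 1)
    (hq : forall n : nat, (1 <= n)%N ->
        q n = laguerre a n + beta n *: laguerre a n.-1)
    (hD : D = poly_of_op P1 (laguerre_op a)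
           \+ (deriv (R:=R) \o poly_of_op P2 (laguerre_op a))) :
  [/\ size P2 = k.+1,
      diff_op_of_order (2 * k + 2) D
    & forall n : nat, D (q n) = lambda n *: q n].
Proof.
have szP2 : size P2 = k.+1 by rewrite hP2; apply: size_backward_difference.
split=> //.
  have := has_leadingD (has_leading_poly_of_laguerre_op a hP1)
    (has_leading_widen (has_leading_deriv
      (has_leading_poly_of_laguerre_op a szP2))).
  rewrite addr0 mul2n addn2 -doubleS => -[f [f_max Tf]].
  exists (fun j : 'I__ => f j); split=> [|p]; last by rewrite hD /= Tf.
  rewrite /= f_max scaler_eq0 negb_or lead_coef_eq0 -size_poly_gt0 hP1.
  by rewrite -size_poly_gt0 size_polyXn.
have D_laguerre n : D (laguerre a n)
    = P1.[- n%:R] *: laguerre a n + P2.[- n%:R] *: (laguerre a n)^`().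
  by rewrite hD /= !poly_of_laguerre_op_eigen derivZ.
have D_lin c u v : D (u + c *: v) = D u + c *: D v.
  by rewrite hD /= !poly_of_laguerre_op_lin derivD derivZ -!mul_polyC; ring.
case=> [|n].
  rewrite hq0 -(laguerre0 a) D_laguerre hlambda laguerre0.
  by rewrite derivC scaler0 addr0.
have P2E x : P2.[x] = P1.[x - 1] - P1.[x].
  by rewrite hP2 !(hornerE, horner_comp).
have nS : - n.+1%:R = - n%:R - 1 :> R by rewrite -natr1 opprD.
rewrite hq // D_lin !D_laguerre hlambda hbeta // !hgamma /= nS.
have -> : (laguerre a n.+1)^`() = (laguerre a n)^`() - laguerre a n.
  by rewrite -deriv_laguerre_rec addrC subrK.
(* [- P2(-n-1) / P2(-n)] is [beta n.+1]: clearing its denominator makes the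
   identity polynomial in the values of [P1] and [P2] *)
have cross : P2.[- n%:R - 1] / P2.[- n%:R] * P2.[- n%:R] = P2.[- n%:R - 1].
  by rewrite divfK // hP2n.
have diff : P1.[- n%:R - 1] = P1.[- n%:R] + P2.[- n%:R].
  by rewrite P2E [RHS]addrC subrK.
move: cross; rewrite diff.
set b := P2.[- n%:R - 1] / _ => cross; rewrite -cross.
rewrite -!mul_polyC !(polyCD, polyCM, polyCN); ring.
Qed.
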